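(* Let $G=(V,E)$ be a finite hypergraph of rank $r$ with at least one edge, let $w:V\to\mathbb{R}_{>0}$ be vertex weights, and let $0<\epsilon<1$. Then the algorithm Cover (defined in the context), on input $(G,w,\epsilon)$, returns a vertex cover $C$ of $G$ whose weight $w(C)$ is at most $\frac{r}{1-\epsilon}$ times the minimum weight of a vertex cover of $G$. The edge weights $p$ implicitly computed by the algorithm form an $\epsilon$-maximal edge packing whose weight $p(E)$ is at least $\frac{1-\epsilon}{r}$ times the maximum weight of an edge packing. Moreover, if all the weights $w(v)$ are integers and $1/\epsilon > w(V)$, then $w(C)$ is at most $r$ times the minimum weight of a vertex cover.
   Context: Hypergraph: a finite vertex set $V$ and a set $E\subseteq 2^V$ of nonempty edges; $E(v)$ is the set of edges containing $v$. The rank $r$ is the maximum size of an edge. For a real-valued function $f$ and a subset $S$ of its domain, $f(S)=\sum_{x\in S}f(x)$. A vertex cover is a set $C\subseteq V$ meeting every edge; its weight is $w(C)$. An edge packing is a function $p:E\to\mathbb{R}_{\ge0}$ with $p(E(v))\le w(v)$ for every $v\in V$; its weight is $p(E)$. An edge packing $p$ is $\epsilon$-maximal if $C_p=\{v\in V: p(E(v))\ge(1-\epsilon)w(v)\}$ is a vertex cover. Algorithm Cover$(G,w,\epsilon)$. 1. For each $v\in V$ in parallel: $w_p(v)\leftarrow w(v)$; $E_p(v)\leftarrow E(v)$; $d_p(v)\leftarrow|E(v)|$. 2. While edges remain, do one iteration: (a) for each remaining edge $e$ in parallel, $\delta(e)\leftarrow\min_{v\in e} w_p(v)/d_p(v)$;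 (b) for each remaining vertex $v$ in parallel, $w_p(v)\leftarrow w_p(v)-\sum_{e\in E_p(v)}\delta(e)$, and if then $w_p(v)\le\epsilon\,w(v)$, delete $v$ and all its incident edges, updating the sets $E_p(\cdot)$ of remaining incident edges and the degrees $d_p(\cdot)=|E_p(\cdot)|$. 3. Return the set of deleted vertices. The edge weights $p$ implicitly computed are: $p(e)=0$ initially, and in each iteration $p(e)$ is increased by $\delta(e)$ for every edge $e$ remaining at the start of that iteration. *)

(* Defs.v *)
From mathcomp Require Import all_boot all_order all_algebra.
From mathcomp Require Import reals.

Set Implicit Arguments.
Unset Strict Implicit.
Unset Printing Implicit Defensive.

Import Order.TTheory GRing.Theory Num.Theory.
Local Open Scope ring_scope.

Definition sumOver (R : realType) (T : finType) (f : T -> R) (S : {set T}) : R :=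
  \sum_(x in S) f x.

(* Minimum of f over A. The pick only supplies a starting value taken from A,
   so this is the true minimum as soon as A is nonempty. *)
Definition minOver (R : realType) (T : finType) (f : T -> R) (A : {set T}) : R :=
  if [pick x in A] is Some x0 then \big[Num.min/f x0]_(x in A) f x else 0.

Section Hypergraph.

(* A hypergraph on V is given by its edge set E; that the edges are nonempty
   (set0 \notin E) is a hypothesis of the theorem. *)
Variables (R : realType) (V : finType).
Implicit Types (E : {set {set V}}) (C : {set V}) (w : V -> R).

Definition edges_at E (v : V) : {set {set V}} := [set e in E | v \in e].

Definition rank E : nat := \max_(e in E) #|e|.

Definition vertex_cover E C : bool := [forall e in E, C :&: e != set0].

Definition min_cover_weight E w : R :=
  minOver (sumOver w) [set C | vertex_cover E C].

(* Functions E -> R are represented by functions on all subsets of V; only the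
   values on E are ever used. *)
Definition edge_packing E w (p : {set V} -> R) : Prop :=
  (forall e, e \in E -> 0 <= p e) /\
  (forall v, sumOver p (edges_at E v) <= w v).

Definition tight_vertices E w (eps : R) (p : {set V} -> R) : {set V} :=
  [set v | (1 - eps) * w v <= sumOver p (edges_at E v)].

Definition eps_maximal_packing E w (eps : R) (p : {set V} -> R) : Prop :=
  edge_packing E w p /\ vertex_cover E (tight_vertices E w eps p).

Definition is_max_packing_weight E w (M : R) : Prop :=
  (exists2 q, edge_packing E w q & sumOver q E = M) /\
  (forall q, edge_packing E w q -> sumOver q E <= M).

(* Remaining vertices, remaining edges, the residual weights w_p, and the
   implicitly computed edge weights p. *)
Record state := State {
  st_V : {set V};
  st_E : {set {set V}};
  st_w : V -> R;
  st_p : {set V} -> R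
}.

Definition init_state E w : state := State [set: V] E w (fun=> 0).

(* E_p(v) and d_p(v) are recomputed from the set of remaining edges. *)
Definition st_deg (s : state) (v : V) : nat := #|edges_at (st_E s) v|.

Definition delta (s : state) (e : {set V}) : R :=
  minOver (fun v => st_w s v / (st_deg s v)%:R) e.

Definition iteration w (eps : R) (s : state) : state :=
  let w' v := if v \in st_V s
              then st_w s v - sumOver (delta s) (edges_at (st_E s) v)
              else st_w s v in
  let D := [set v in st_V s | w' v <= eps * w v] in
  State (st_V s :\: D)
        [set e in st_E s | [disjoint e & D]]
        w'
        (fun e => if e \in st_E s then st_p s e + delta s e else st_p s e).

(* Big-step semantics of the while loop: an inductive relation, so relating s to
   some t includes termination. *)
Inductive loop w (eps : R) : state -> state -> Prop :=
| loop_stop s : st_E s = set0 -> loop w eps s s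
| loop_next s t : st_E s != set0 -> loop w eps (iteration w eps s) t ->
    loop w eps s t.

(* Cover(G, w, eps) terminates, returns C and implicitly computes p. *)
Definition Cover_returns E w (eps : R) (C : {set V}) (p : {set V} -> R) : Prop :=
  exists t, [/\ loop w eps (init_state E w) t, C = ~: st_V t & p = st_p t].

End Hypergraph.

(* Main.v *)
(** Local-ratio argument. Throughout the loop w_p(v) = w(v) - p(E(v)) >= 0, so p
    is always a packing. The loop stops because a vertex minimizing w_p / d_p
    among those with a remaining edge has its residual weight exhausted in the
    next iteration. A deleted vertex v has p(E(v)) >= (1 - eps) w(v); summing over
    the returned cover C counts each edge at most r times, so
    (1 - eps) w(C) <= r p(E), and weak LP duality between covers and packings
    gives both approximation ratios. In the integral case
    eps w(C) <= eps w(V) < 1, hence w(C) < r OPT + 1 with both sides integers. *)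
From mathcomp Require Import boolp classical_sets topology normedtype derive.
Require Import Defs.
From mathcomp Require Import all_boot all_order all_algebra.
From mathcomp Require Import reals lra.

Set Implicit Arguments.
Unset Strict Implicit.
Unset Printing Implicit Defensive.

Import Order.TTheory GRing.Theory Num.Theory.
Import numFieldNormedType.Exports.
Local Open Scope ring_scope.

(** * Minima over finite sets *)

Section MinOver.
Variables (R : realType) (T : finType) (f : T -> R).

Lemma minOver_le (A : {set T}) x : x \in A -> minOver f A <= f x.
Proof.
rewrite /minOver; case: pickP => [x0 _ xA|A0]; last by rewrite A0.
exact: bigmin_le_cond.
Qed.

Lemma minOver_attained (A : {set T}) :
  A != set0 -> exists2 x, x \in A & minOver f A = f x.
Proof.
rewrite /minOver; case: pickP => [x0 x0A _|A0]; last first.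
  by case/set0Pn => x; rewrite A0.
have [y yA y_min] : exists2 y, y \in A & forall z, z \in A -> f y <= f z.
  by case: (Order.TotalTheory.arg_minP f x0A) => y yA y_min; exists y.
exists y => //; apply/eqP; rewrite eq_le bigmin_le_cond //=.
by apply: le_bigmin => [|z]; apply: y_min.
Qed.

End MinOver.

(** * Double counting, packing-cover duality and the loop invariant *)

Section CoverAlgorithm.
Variables (R : realType) (V : finType).
Implicit Types (E : {set {set V}}) (w : V -> R) (p : {set V} -> R).

Lemma sumOver_double_count p E (C : {set V}) :
  \sum_(v in C) sumOver p (edges_at E v) =
  \sum_(e in E) p e * #|C :&: e|%:R.
Proof.
have sumE v : sumOver p (edges_at E v) = \sum_(e in E | v \in e) p e.
  by apply: eq_bigl => e; rewrite inE.
rewrite (eq_bigr _ (fun v _ => sumE v)).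
rewrite (exchange_big_dep (mem E)) /=; last by move=> v e _ /andP[].
apply: eq_bigr => e eE.
rewrite (eq_bigl (mem (C :&: e))) ?sumr_const ?mulr_natr // => v.
by rewrite -topredE /= inE eE.
Qed.

(** Summing the loads [p(E(v))] over the cover counts each edge at least once, and each load is at
    most [w v]. *)
Lemma weak_duality E w p (C : {set V}) :
  edge_packing E w p -> vertex_cover E C -> sumOver p E <= sumOver w C.
Proof.
move=> [p_ge0 p_le] /forallP C_cover.
apply: (@le_trans _ _ (\sum_(v in C) sumOver p (edges_at E v))).
  rewrite sumOver_double_count; apply: ler_sum => e eE.
  rewrite ler_peMr ?p_ge0 // ler1n card_gt0.
  by have /implyP := C_cover e; apply.
by apply: ler_sum.
Qed.

Lemma card_le_rank E (e : {set V}) : e \in E -> (#|e| <= rank E)%N.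
Proof. by move=> eE; rewrite /rank (bigD1 e) //= leq_maxl. Qed.

Lemma sum_edges_at_le_rank E p (C : {set V}) :
  (forall e, e \in E -> 0 <= p e) ->
  \sum_(v in C) sumOver p (edges_at E v) <= (rank E)%:R * sumOver p E.
Proof.
move=> p_ge0; rewrite sumOver_double_count mulr_sumr; apply: ler_sum => e eE.
rewrite mulrC ler_wpM2r ?p_ge0 // ler_nat.
apply: leq_trans (subset_leq_card (subsetIr _ _)) _.
exact: card_le_rank.
Qed.

(** Given [inv_w], the field [inv_w_ge0] is the packing condition and [inv_deleted] is tightness of
    the deleted vertices. [inv_edges] turns an empty set of remaining edges into the covering
    property. *)
Record cover_invariant E w (eps : R) (s : state R V) : Prop := CoverInvariant {
  inv_edges : st_E s = [set e in E | e \subset st_V s];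
  inv_p_ge0 : forall e, 0 <= st_p s e;
  inv_w : forall v, st_w s v = w v - sumOver (st_p s) (edges_at E v);
  inv_w_ge0 : forall v, 0 <= st_w s v;
  inv_deleted : forall v, v \notin st_V s -> st_w s v <= eps * w v
}.

Lemma cover_invariant_init E w eps :
  (forall v, 0 < w v) -> cover_invariant E w eps (init_state E w).
Proof.
move=> w_gt0; split=> //= [|v|v|v]; last by rewrite inE.
- by apply/setP => e; rewrite inE subsetT andbT.
- by rewrite /sumOver big1 // subr0.
- exact: ltW.
Qed.

(** * One iteration: preservation of the invariant and progress *)

Section Step.
Variables (E : {set {set V}}) (w : V -> R) (eps : R) (s : state R V).
Hypothesis edges_nonempty : set0 \notin E.
Hypothesis eps_gt0 : 0 < eps.
Hypothesis w_gt0 : forall v, 0 < w v.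
Hypothesis s_inv : cover_invariant E w eps s.

Let ratio v := st_w s v / (st_deg s v)%:R.

Lemma ratio_ge0 v : 0 <= ratio v.
Proof. by rewrite divr_ge0 ?ler0n ?(inv_w_ge0 s_inv). Qed.

Lemma edge_neq0 e : e \in st_E s -> e != set0.
Proof.
by rewrite (inv_edges s_inv) inE => /andP[eE _]; apply: contraNneq edges_nonempty => <-.
Qed.

Lemma delta_ge0 e : e \in st_E s -> 0 <= delta s e.
Proof.
by move=> /edge_neq0 /(minOver_attained ratio)[v _ ratio_v];
   rewrite /delta ratio_v ratio_ge0.
Qed.

(** Equality holds at positive degree; at degree 0 the sum is empty, so only the inequality
    survives. *)
Lemma sum_ratio_le v : \sum_(e in edges_at (st_E s) v) ratio v <= st_w s v.
Proof.
rewrite sumr_const /ratio /st_deg.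
have [->|d_neq0] := eqVneq #|edges_at (st_E s) v| 0%N.
  by rewrite mulr0n (inv_w_ge0 s_inv).
by rewrite -[leLHS]mulr_natr divfK // pnatr_eq0.
Qed.

Lemma sum_delta_le v : sumOver (delta s) (edges_at (st_E s) v) <= st_w s v.
Proof.
apply: le_trans (sum_ratio_le v); apply: ler_sum => e.
by rewrite inE => /andP[_ ve]; exact: (minOver_le ratio ve).
Qed.

Lemma edges_at_deleted v : v \notin st_V s -> edges_at (st_E s) v = set0.
Proof.
move=> vV; apply/setP => e; rewrite !inE (inv_edges s_inv) !inE.
apply/negbTE/negP => /andP[/andP[_ /subsetP eV] /eV].
by rewrite (negbTE vV).
Qed.

(** The case distinction in [iteration] disappears because a deleted vertex has no remaining edges
    and so loses nothing. *)
Lemma iteration_w v :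
  st_w (iteration w eps s) v =
  st_w s v - sumOver (delta s) (edges_at (st_E s) v).
Proof.
rewrite /=; case: ifPn => // vV.
by rewrite edges_at_deleted // /sumOver big_set0 subr0.
Qed.

Lemma iteration_p v :
  sumOver (st_p (iteration w eps s)) (edges_at E v) =
  sumOver (st_p s) (edges_at E v) + sumOver (delta s) (edges_at (st_E s) v).
Proof.
(* All three sums are extended by zero to every subset of [V], so that the identity can be checked
   edge by edge. *)
rewrite /sumOver [X in _ = _ + X]big_mkcond (big_mkcond (fun e => e \in edges_at E v)).
rewrite [X in _ = X + _]big_mkcond -big_split /=; apply: eq_bigr => e _.
rewrite !inE; have [eS|eS] := boolP (e \in st_E s) => /=.
  move: (eS); rewrite (inv_edges s_inv) inE => /andP[-> _] /=.
  by case: ifP; rewrite ?addr0.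
by rewrite addr0.
Qed.

Lemma cover_invariant_iteration : cover_invariant E w eps (iteration w eps s).
Proof.
split=> [|e|v|v|v].
- apply/setP => e; rewrite /= !inE (inv_edges s_inv) inE.
  by rewrite subsetD andbA.
- rewrite /=; case: ifPn => eS; last exact: (inv_p_ge0 s_inv).
  by rewrite addr_ge0 ?(inv_p_ge0 s_inv) ?delta_ge0.
- by rewrite iteration_w iteration_p (inv_w s_inv) opprD addrA.
- by rewrite iteration_w subr_ge0 sum_delta_le.
(* A vertex deleted earlier keeps its residual weight; one deleted now has just passed the threshold
   test. *)
- rewrite /= !inE negb_and negbK; case: ifPn => //= vV; last first.
    by move=> _; exact: (inv_deleted s_inv).
  by rewrite orbF.
Qed.

Lemma iteration_progress :
  st_E s != set0 -> (#|st_E (iteration w eps s)| < #|st_E s|)%N.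
Proof.
case/set0Pn => e0 e0S; have /set0Pn[v0 v0e0] := edge_neq0 e0S.
(* Vertices without remaining edges are excluded: division by zero gives them ratio 0, which would
   make them spurious minimizers. *)
pose U := [set v | edges_at (st_E s) v != set0].
have in_U e v : e \in st_E s -> v \in e -> v \in U.
  by move=> eS ve; rewrite inE; apply/set0Pn; exists e; rewrite inE eS.
have [v vU v_min] : exists2 v, v \in U & forall u, u \in U -> ratio v <= ratio u.
  case: (Order.TotalTheory.arg_minP ratio (in_U _ _ e0S v0e0)) => v vU v_min.
  by exists v.
(* All vertices of a remaining edge lie in [U], so [v] attains the minimum on each of its edges; its
   degree times its ratio is then its whole residual weight. *)
have delta_v e : e \in edges_at (st_E s) v -> delta s e = ratio v.
  rewrite inE => /andP[eS ve]; apply/eqP; rewrite eq_le (minOver_le ratio ve) /=.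
  have [u ue ratio_u] := minOver_attained ratio (edge_neq0 eS).
  by rewrite [leRHS]ratio_u v_min // (in_U e).
have w'v : st_w (iteration w eps s) v = 0.
  rewrite iteration_w /sumOver (eq_bigr _ delta_v) sumr_const.
  rewrite -mulr_natr divfK ?subrr // pnatr_eq0 cards_eq0.
  by move: vU; rewrite inE.
have [e] : exists e, e \in edges_at (st_E s) v by apply/set0Pn; move: vU; rewrite inE.
rewrite inE => /andP[eS ve].
apply: proper_card; apply/properP; split.
  by apply/subsetP => f; rewrite inE => /andP[].
exists e => //; rewrite inE eS /=; apply/pred0Pn; exists v; rewrite /= ve !inE.
move: w'v => /= ->; rewrite mulr_ge0 ?(ltW eps_gt0) ?(ltW (w_gt0 v)) // andbT.
by apply: contraT => /edges_at_deleted v_isolated; move: vU; rewrite inE v_isolated eqxx.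
Qed.

End Step.

(** Induction on the number of remaining edges, which each iteration strictly decreases. *)
Lemma loop_terminates E w eps s :
  set0 \notin E -> 0 < eps -> (forall v, 0 < w v) ->
  cover_invariant E w eps s ->
  exists t, [/\ loop w eps s t, st_E t = set0 & cover_invariant E w eps t].
Proof.
move=> E0 eps_gt0 w_gt0; have [n] := ubnP #|st_E s|.
elim: n s => // n IHn s s_lt s_inv.
have [S0|S_neq0] := eqVneq (st_E s) set0; first by exists s; split=> //; exact: loop_stop.
have lt_n := leq_trans (iteration_progress E0 eps_gt0 w_gt0 s_inv S_neq0) s_lt.
have [t [st t0 t_inv]] := IHn _ lt_n (cover_invariant_iteration E0 s_inv).
by exists t; split=> //; exact: loop_next.
Qed.

(** * Consequences of the invariant once the loop has stopped *)

Section FinalState.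
Variables (E : {set {set V}}) (w : V -> R) (eps : R) (t : state R V).
Hypothesis t_inv : cover_invariant E w eps t.
Hypothesis t_done : st_E t = set0.

Lemma final_packing : edge_packing E w (st_p t).
Proof.
split=> [e _|v]; first exact: (inv_p_ge0 t_inv).
by rewrite -subr_ge0 -(inv_w t_inv) (inv_w_ge0 t_inv).
Qed.

(** An edge missing the deleted vertices would lie inside [st_V t] and hence still remain. *)
Lemma final_cover : vertex_cover E (~: st_V t).
Proof.
apply/forallP => e; apply/implyP => eE.
apply/negP => /eqP Ce; have := in_set0 e; rewrite -t_done (inv_edges t_inv) inE eE /= => /negP[].
apply/subsetP => v ve; apply: contraT => vV.
by have := in_set0 v; rewrite -Ce !inE vV ve.
Qed.

Lemma final_tight : ~: st_V t \subset tight_vertices E w eps (st_p t).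
Proof.
apply/subsetP => v; rewrite !inE => /(inv_deleted t_inv).
by rewrite (inv_w t_inv) => ?; lra.
Qed.

Lemma final_weight :
  (1 - eps) * sumOver w (~: st_V t) <= (rank E)%:R * sumOver (st_p t) E.
Proof.
apply: le_trans (sum_edges_at_le_rank (~: st_V t) (proj1 final_packing)).
rewrite mulr_sumr; apply: ler_sum => v vC.
by have := subsetP final_tight _ vC; rewrite inE.
Qed.

End FinalState.

End CoverAlgorithm.

Lemma vertex_coverS (V : finType) (E : {set {set V}}) (C D : {set V}) :
  C \subset D -> vertex_cover E C -> vertex_cover E D.
Proof.
move=> CD /forallP C_cover; apply/forallP => e; apply/implyP => eE.
have /implyP/(_ eE)/set0Pn[v vCe] := C_cover e.
by apply/set0Pn; exists v; exact: (subsetP (setSI e CD)).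
Qed.

Lemma rank_gt0 (V : finType) (E : {set {set V}}) :
  set0 \notin E -> E != set0 -> (0 < rank E)%N.
Proof.
move=> E0 /set0Pn[e eE].
apply: leq_trans (card_le_rank eE).
by rewrite card_gt0; apply: contraNneq E0 => <-.
Qed.

Lemma int_le_ltD1 (R : realType) (x y : R) :
  x \is a Num.int -> y \is a Num.int -> x < y + 1 -> x <= y.
Proof.
by move=> /intrP[m ->] /intrP[n ->]; rewrite -(intrD _ n 1) ltr_int ler_int ltzD1.
Qed.

(** * Existence of a maximum packing by compactness *)

Section MaximumPacking.
Variables (R : realType) (V : finType) (E : {set {set V}}) (w : V -> R).
Hypothesis edges_nonempty : set0 \notin E.
Hypothesis w_ge0 : forall v, 0 <= w v.

Local Open Scope classical_set_scope.

Lemma packing_le_vertex (p : {set V} -> R) (e : {set V}) (v : V) :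
  edge_packing E w p -> e \in E -> v \in e -> p e <= w v.
Proof.
move=> [p_ge0 p_le] eE ve; apply: le_trans (p_le v).
rewrite /sumOver (bigD1 e) ?inE ?eE ?ve //= lerDl sumr_ge0 // => f.
by rewrite inE => /andP[/andP[/p_ge0]].
Qed.

(* Values off E are unconstrained by edge_packing, so compactness needs them
   pinned inside a box. *)
Lemma max_packing_exists : exists M, is_max_packing_weight E w M.
Proof.
(* One bound for all edges: a packing gives an edge at most the weight of any of its vertices. *)
pose B := \sum_v w v.
have B_ge v : w v <= B by rewrite /B (bigD1 v) //= lerDl sumr_ge0.
have B_ge0 : 0 <= B by rewrite sumr_ge0.
(* In the product topology the box is compact by Tychonoff, and finite sums of coordinates are
   continuous, so the packing constraints are closed. *)
pose F := prod_topology (fun _ : {set V} => R).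
have sum_cont (S : {set {set V}}) : continuous (fun p : F => sumOver p S).
  rewrite /sumOver; apply: continuous_big => //; first exact: add_continuous.
  by move=> e _; exact: (@proj_continuous _ (fun _ : {set V} => R) e).
pose box : set F := [set p | forall e, `[0, B] (p e)].
pose A : set F :=
  box `&` \bigcap_(v in [set: V]) [set p : F | sumOver p (edges_at E v) <= w v].
have A_compact : compact A.
  apply: compact_closedI.
    by apply: (@tychonoff _ (fun _ => R) (fun _ => `[0, B])) => e; exact: segment_compact.
  apply: closed_bigI => v _.
  apply: (@preimage_closed F R^o (fun p : F => sumOver p (edges_at E v))
            [set x | x <= w v]) ; last exact: closed_le.
  by move=> p _; exact: sum_cont.
have A0 : A !=set0.
  exists (fun=> 0); split=> [e|v _] /=; first by rewrite in_itv /= lexx.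
  by rewrite /sumOver big1.
have [c /set_mem[cbox ccap] c_max] :=
  compact_EVT_max A0 A_compact (continuous_subspaceT (sum_cont E)).
exists (sumOver c E); split.
  exists c => //; split=> [e eE|v]; last exact: ccap.
  by have := cbox e; rewrite /= in_itv /= => /andP[].
move=> q q_pack; have [q_ge0 q_le] := q_pack.
(* Zeroing [q] off [E] puts it in the box without changing any relevant sum. *)
pose q' : F := fun e => if e \in E then q e else 0.
have q'E (S : {set {set V}}) : S \subset E -> sumOver q' S = sumOver q S.
  by move=> /subsetP SE; apply: eq_bigr => e /SE eE; rewrite /q' eE.
rewrite -(q'E E) //; apply: c_max; apply/mem_set; split=> [e|v _] /=; last first.
  by rewrite q'E //; apply/subsetP => e; rewrite inE => /andP[].
rewrite in_itv /= /q'; case: ifPn => [eE|_]; last by rewrite lexx.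
rewrite q_ge0 //=.
have /set0Pn[v ve] : e != set0 by apply: contraNneq edges_nonempty => <-.
exact: le_trans (packing_le_vertex q_pack eE ve) (B_ge v).
Qed.

End MaximumPacking.

Theorem mainTheorem2 (R : realType) (V : finType) (E : {set {set V}})
    (w : V -> R) (eps : R) (r : nat)
    (edges_nonempty : set0 \notin E)
    (has_edge : E != set0)
    (rank_E : rank E = r)
    (w_gt0 : forall v : V, 0 < w v)
    (eps_gt0 : 0 < eps) (eps_lt1 : eps < 1) :
  exists (C : {set V}) (p : {set V} -> R),
    Cover_returns E w eps C p /\
    [/\ vertex_cover E C /\
          sumOver w C <= r%:R / (1 - eps) * min_cover_weight E w,
        eps_maximal_packing E w eps p,
        exists M : R, is_max_packing_weight E w M /\
          (1 - eps) / r%:R * M <= sumOver p E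
      & (forall v : V, w v \is a Num.int) -> sumOver w [set: V] < 1 / eps ->
          sumOver w C <= r%:R * min_cover_weight E w].
Proof.
have [t [run t_done t_inv]] := loop_terminates edges_nonempty eps_gt0 w_gt0
  (cover_invariant_init E eps w_gt0).
have p_pack := final_packing t_inv.
have C_cover := final_cover t_inv t_done.
have := final_weight t_inv; rewrite rank_E => C_weight.
have e1_gt0 : 0 < 1 - eps by rewrite subr_gt0.
have r_gt0 : 0 < r%:R :> R by rewrite ltr0n -rank_E rank_gt0.
exists (~: st_V t), (st_p t); split; first by exists t.
(* The returned cover shows that the minimum ranges over a nonempty set, so it is attained and not
   the default 0. *)
have [C' C'_cover C'_min] : exists2 C', vertex_cover E C' &
    min_cover_weight E w = sumOver w C'.
  have [|C'] := @minOver_attained _ _ (sumOver w) [set C | vertex_cover E C].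
    by apply/set0Pn; exists (~: st_V t); rewrite inE.
  by rewrite inE => C'_cover C'_min; exists C'.
have C_opt : (1 - eps) * sumOver w (~: st_V t) <= r%:R * min_cover_weight E w.
  by rewrite C'_min (le_trans C_weight) // ler_pM2l // weak_duality.
split.
- by split=> //; rewrite mulrAC ler_pdivlMr // mulrC.
- by split=> //; exact: vertex_coverS (final_tight t_inv) C_cover.
- have [M M_max] := max_packing_exists edges_nonempty (fun v => ltW (w_gt0 v)).
  exists M; split=> //; have [[q q_pack <-] _] := M_max.
  rewrite mulrAC ler_pdivrMr // [leRHS]mulrC (le_trans _ C_weight) //.
  by rewrite ler_pM2l // weak_duality.
- move=> w_int eps_small.
  have sum_int S : sumOver w S \is a Num.int by apply: rpred_sum => v _.
  apply: int_le_ltD1 => //; first by rewrite C'_min rpredM ?rpred_nat.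
  have C_le : sumOver w (~: st_V t) <= sumOver w [set: V].
    rewrite /sumOver [leRHS](big_setID (~: st_V t)) setTI lerDl sumr_ge0 // => v _.
    exact: ltW.
  (* Adding this to [C_opt] removes the factor [1 - eps] at a cost below 1, which integrality
     absorbs. *)
  have : eps * sumOver w (~: st_V t) < 1.
    by rewrite mulrC -ltr_pdivlMr // (le_lt_trans C_le).
  move: C_opt; lra.
Qed.
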